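(* Let $T$ be a tree that is not isomorphic to any of the following four trees: $K_1$, $K_{1,2}$, $K_{1,3}$, and the balanced binary tree on $7$ vertices. If $\Delta(T)\le 3$, then $\mathcal{E}(T)\ge |T|$.
   Context: All graphs are finite, simple and undirected, and a tree has at least one vertex. For a graph $G$, $|G|$ is its number of vertices and $\Delta(G)$ its maximum degree. If $|G|=n$ and $\mu_1\ge\cdots\ge\mu_n$ are the eigenvalues of the adjacency matrix of $G$ (with multiplicity), the energy of $G$ is $\mathcal{E}(G)=|\mu_1|+\cdots+|\mu_n|$. $K_1$ is the single-vertex graph and $K_{1,k}$ is the star with $k$ leaves. The balanced binary tree on $7$ vertices consists of a root adjacent to two vertices, each of which is adjacent to two further vertices that are leaves. *)

(* Defs.v *)
From mathcomp Require Import all_boot all_order all_algebra.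
From mathcomp Require Import complex.
From mathcomp Require Import reals.

Set Implicit Arguments.
Unset Strict Implicit.
Unset Printing Implicit Defensive.

Import Order.TTheory GRing.Theory Num.Theory.

Record sgraph := SGraph {
  vertex :> finType;
  adj : rel vertex;
  adj_sym : symmetric adj;
  adj_irr : irreflexive adj }.

Definition isomorphic (G H : sgraph) : Prop :=
  exists2 f : G -> H, bijective f & forall x y, adj (f x) (f y) = adj x y.

Definition degree (G : sgraph) (x : G) : nat := #|[set y | adj x y]|.

Definition max_degree (G : sgraph) : nat := \max_(x : G) degree x.

Definition connected (G : sgraph) : Prop :=
  forall x y : G, connect (@adj G) x y.

(* [ucycle] also accepts the back-and-forth walk [:: x; y] along an edge,
   so a graph cycle is a [ucycle] with at least three vertices. *)
Definition acyclic (G : sgraph) : Prop :=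
  forall c : seq G, ucycle (@adj G) c -> size c < 3.

Definition is_tree (G : sgraph) : Prop :=
  [/\ 0 < #|G|, connected G & acyclic G].

Fact K1_sym : symmetric (fun _ _ : 'I_1 => false).
Proof. by []. Qed.

Fact K1_irr : irreflexive (fun _ : 'I_1 => xpred0).
Proof. by []. Qed.

Definition K1 : sgraph := SGraph K1_sym K1_irr.

(* The star K_{1,k}: vertex 0 is the centre, vertices 1, ..., k the leaves. *)
Definition star_adj (k : nat) : rel 'I_k.+1 :=
  fun i j => (i == ord0) (+) (j == ord0).

Fact star_sym k : symmetric (@star_adj k).
Proof. by move=> i j; rewrite /star_adj addbC. Qed.

Fact star_irr k : irreflexive (@star_adj k).
Proof. by move=> i; rewrite /star_adj addbb. Qed.

Definition star (k : nat) : sgraph := SGraph (@star_sym k) (@star_irr k).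

(* Heap numbering: the root is 0 and the children of i are 2i+1 and 2i+2. *)
Definition heap_child (i j : nat) : bool := (j == i.*2.+1) || (j == i.*2.+2).

Definition binary7_adj : rel 'I_7 :=
  fun i j => heap_child i j || heap_child j i.

Fact binary7_sym : symmetric binary7_adj.
Proof. by move=> i j; rewrite /binary7_adj orbC. Qed.

Fact binary7_irr : irreflexive binary7_adj.
Proof. by case; do 7?case. Qed.

Definition binary7 : sgraph := SGraph binary7_sym binary7_irr.

Local Open Scope ring_scope.

Definition adjmx (R : nzRingType) (G : sgraph) : 'M[R]_#|G| :=
  \matrix_(i, j) (adj (enum_val i) (enum_val j))%:R.

Lemma char_poly_diag (R : comNzRingType) n (d : 'rV[R]_n) :
  char_poly (diag_mx d) = \prod_(i < n) ('X - (d 0 i)%:P).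
Proof.
rewrite char_poly_trig ?diag_mx_is_trig //.
by apply: eq_bigr => i _; rewrite mxE eqxx mulr1n.
Qed.

Lemma char_poly_similar (R : comUnitRingType) n (P A : 'M[R]_n) :
  P \in unitmx -> char_poly (invmx P *m A *m P) = char_poly A.
Proof.
move=> Pu; have PV : map_mx polyC (invmx P) *m map_mx polyC P = 1%:M.
  by rewrite -map_mxM mulVmx // map_mx1.
rewrite /char_poly.
have -> : char_poly_mx (invmx P *m A *m P) =
    map_mx polyC (invmx P) *m char_poly_mx A *m map_mx polyC P.
  rewrite /char_poly_mx !map_mxM mulmxBr mulmxBl; congr (_ - _).
  by rewrite -mulmxA mul_scalar_mx -scalemxAr PV scalemx1.
rewrite !det_mulmx mulrC mulrA -det_mulmx.
by rewrite -map_mxM mulmxV // map_mx1 det1 mul1r.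
Qed.

Lemma adjmx_spectrum (R : rcfType) (G : sgraph) :
  exists mu : #|G|.-tuple R,
    sorted (fun x y : R => y <= x) mu &&
    (char_poly (adjmx R G) == \prod_(x <- mu) ('X - x%:P)).
Proof.
set A := adjmx R G; pose toC := @real_complex_def R (Phant R).
pose B : 'M[R[i]]_#|G| := map_mx toC A.
have Bsym : B \is symmetricmx.
  apply/is_hermitianmxP; rewrite expr0 scale1r map_mx_id //.
  by apply/matrixP => i j; rewrite !mxE adj_sym.
have Breal : B \is a mxOver Num.real.
  by apply/mxOverP => i j; rewrite mxE; apply/complex_realP; exists (A i j).
have Bherm := realsym_hermsym Bsym Breal.
have /orthomx_spectralP Beq := hermitian_normalmx Bherm.
have dreal := hermitian_spectral_diag_real Bherm.
pose d i := complex.Re (spectral_diag B 0 i).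
pose s := [seq d i | i <- enum 'I_#|G|].
have sz : size (sort (fun x y : R => y <= x) s) == #|G|.
  by rewrite size_sort size_map size_enum_ord.
exists (Tuple sz); apply/andP; split.
  by apply: sort_sorted => x y; exact: le_total.
rewrite (perm_big s) /= ?perm_sort // big_map big_enum /=.
apply/eqP/(map_poly_inj toC).
rewrite map_char_poly -/B {1}Beq char_poly_similar ?spectral_unit //.
rewrite char_poly_diag rmorph_prod; apply: eq_bigr => i _.
rewrite rmorphB /= map_polyX map_polyC; congr ('X - _%:P).
by apply/esym/RRe_real/mxOverP.
Qed.

(* The eigenvalues of the adjacency matrix, with multiplicity, in
   nonincreasing order: the roots of its characteristic polynomial. *)
Definition eigenvalues (R : rcfType) (G : sgraph) : #|G|.-tuple R :=
  xchoose (adjmx_spectrum R G).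

Lemma eigenvalues_sorted (R : rcfType) (G : sgraph) :
  sorted (fun x y : R => y <= x) (eigenvalues R G).
Proof. by case/andP: (xchooseP (adjmx_spectrum R G)). Qed.

Lemma char_poly_adjmx (R : rcfType) (G : sgraph) :
  char_poly (adjmx R G) = \prod_(x <- eigenvalues R G) ('X - x%:P).
Proof. by case/andP: (xchooseP (adjmx_spectrum R G)) => _ /eqP. Qed.

Definition energy (R : rcfType) (G : sgraph) : R :=
  \sum_(x <- eigenvalues R G) `|x|.

(* Main.v *)
From HB Require Import structures.
Require Import Defs.
From mathcomp Require Import all_boot all_order all_algebra all_fingroup.
From mathcomp Require Import complex.
From mathcomp Require Import reals.
From mathcomp Require Import ring zify.
From Stdlib Require BinNat Nnat.

(** The energy is the nuclear norm of the adjacency matrix.  The largest value of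
    the sum over j of |(U A U^-1)_jj|, for U unitary, is that norm
    ([diag_conj_le]); choosing for U the direct sum of eigenbases of two diagonal
    blocks shows that energy is superadditive when the vertex set is cut in two
    ([nuclear_block], [rel_energy_cat]).  So cutting an edge of a tree reduces the
    claim to the two components, unless one of them is exceptional (one of the
    four excluded trees).

    Hence consider a tree none of whose edges has two non-exceptional sides.
    Root it, and descend from the root to a lowest non-exceptional subtree u.
    The branches of u are exceptional, and so is what remains of the tree above
    u.  As exceptional trees have at most seven vertices, only finitely many
    trees are left ([descend], [settled]).

    For those, the energy is bounded from below by counting closed walks.  With
      p(x) = (1624 x^2 - 1198 x^4 + 565 x^6 - 145 x^8 + 19 x^10 - x^12) / 864
    one has p(x) <= |x| for every real x ([norm_ge_minorant]), so the energy is
    at least the trace of p(A), a combination of numbers of closed walks of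
    length at most 12.  It turns out that this one polynomial settles every
    remaining case ([all_settled]).

    To make the case analysis computable, trees are handled as labelled binary
    trees.  A tree of maximum degree at most 3 rooted at a vertex of degree at
    most 2 is such a binary tree ([tree_embedded]); so are both sides of any of
    its edges, each rooted at the endpoint of the edge it contains.  The side above
    the edge is then hung from its lowest vertex, so the descent is a zipper whose
    context is itself a binary tree. *)

Set Implicit Arguments.
Unset Strict Implicit.
Unset Printing Implicit Defensive.

Import Order.TTheory GRing.Theory Num.Theory.

(** * A polynomial below the absolute value *)

Section Minorant.
Local Open Scope ring_scope.
Variable F : numFieldType.

(** The substitution x = 2 / (1 + t) makes all coefficients positive and settles
    x <= 2; for x = 2 + t only the coefficient of t is negative, and the square
    (6 - 15 t)^2 absorbs it. *)
Lemma minorant_cofactor_ge0 (x : F) : 0 <= x ->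
  0 <= x^+7 + 6*x^+6 + 4*x^+5 - 42*x^+4 - 91*x^+3 + 24*x^+2 + 242*x + 216.
Proof.
move=> x0; have [x2|x2] := real_leP (ger0_real x0) (realn _ 2).
  have s0 : 0 <= 2 - x by rewrite subr_ge0.
  (* Multiplying by 2^7 makes the identity homogeneous in x and 2 - x = t x. *)
  rewrite -(pmulr_rge0 _ (_ : 0 < 128)) //.
  have -> : 128 * (x^+7 + 6*x^+6 + 4*x^+5 - 42*x^+4 - 91*x^+3 + 24*x^+2
                   + 242*x + 216)
    = 36 * x^+7 + 608 * (x^+6 * (2 - x)) + 6500 * (x^+5 * (2 - x)^+2)
      + 14616 * (x^+4 * (2 - x)^+3) + 14572 * (x^+3 * (2 - x)^+4)
      + 7536 * (x^+2 * (2 - x)^+5) + 1996 * (x * (2 - x)^+6)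
      + 216 * (2 - x)^+7 by ring.
  by rewrite !addr_ge0 ?mulr_ge0 ?exprn_ge0.
have t0 : 0 <= x - 2 by rewrite subr_ge0 ltW.
have -> : x^+7 + 6*x^+6 + 4*x^+5 - 42*x^+4 - 91*x^+3 + 24*x^+2 + 242*x + 216
  = (6 - 15 * (x - 2))^+2 + 2 * (x - 2) + 677 * (x - 2)^+2
    + 1253 * (x - 2)^+3 + 638 * (x - 2)^+4 + 160 * (x - 2)^+5
    + 20 * (x - 2)^+6 + (x - 2)^+7 by ring.
have sq : 0 <= (6 - 15 * (x - 2)) ^+ 2.
  by rewrite -realEsqr rpredB ?rpredM ?realn ?ger0_real.
by rewrite !addr_ge0 ?sq ?mulr_ge0 ?exprn_ge0.
Qed.

(** The minorant equals the absolute value at 0, 1, -1, 2 and -2.  These contacts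
    are forced: the single edge, with spectrum 1, -1, and the tree made of two
    adjacent vertices with two leaves each, with spectrum 2, 1, 0, 0, -1, -2, have
    energy equal to their order.  Among the polynomials of degree 12 with these
    contacts, this one has small coefficients and is large enough for every case
    of [all_settled]. *)
Lemma norm_ge_minorant (x : F) : x \is Num.real ->
  1624 * x^+2 + 565 * x^+6 + 19 * x^+10 <=
  864 * `|x| + 1198 * x^+4 + 145 * x^+8 + x^+12.
Proof.
move=> xr; have ev m : x ^+ m.*2 = `|x| ^+ m.*2.
  by rewrite -!mul2n !exprM real_normK.
rewrite (ev 1%N) (ev 2) (ev 3) (ev 4) (ev 5) (ev 6).
have := normr_ge0 x; move: `|x| => {ev xr}x x0.
rewrite -subr_ge0.
have -> : 864 * x + 1198 * x^+4 + 145 * x^+8 + x^+12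
   - (1624 * x^+2 + 565 * x^+6 + 19 * x^+10)
  = x * ((x - 1) * (x - 2))^+2 *
    (x^+7 + 6*x^+6 + 4*x^+5 - 42*x^+4 - 91*x^+3 + 24*x^+2 + 242*x + 216) by ring.
apply: mulr_ge0; last exact: minorant_cofactor_ge0.
apply: mulr_ge0 => //; rewrite -realEsqr rpredM ?rpredB ?realn ?ger0_real //.
Qed.
End Minorant.

(** * The nuclear norm of a normal matrix *)

Section NuclearNorm.
Local Open Scope ring_scope.
Local Open Scope sesquilinear_scope.
Variable C : numClosedFieldType.

(** For normal matrices, the sum of the moduli of the eigenvalues is the nuclear
    norm. *)
Definition nuclear n (A : 'M[C]_n) : C := \sum_i `|spectral_diag A 0 i|.

Lemma unitary_col n (U : 'M[C]_n) j : U \is unitarymx ->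
  \sum_i `|U i j| ^+ 2 = 1.
Proof.
rewrite -trmxC_unitary => /unitarymxP; rewrite trmxCK => /matrixP/(_ j j).
rewrite !mxE eqxx mulr1n => <-; apply: eq_bigr => i _.
by rewrite !mxE normCK mulrC.
Qed.

(** In an orthonormal eigenbasis, the diagonal of U A U^-1 is the image of the
    spectrum under the matrix of the |W_ji|^2, for a unitary W; the columns of that
    matrix sum to 1, so the sum of the moduli does not grow. *)
Lemma diag_conj_le n (A U : 'M[C]_n) : A \is normalmx -> U \is unitarymx ->
  \sum_j `|(U *m A *m U^t*) j j| <= nuclear A.
Proof.
move=> An Uu; pose W := U *m (spectralmx A)^t*.
have Wu : W \is unitarymx.
  by rewrite mul_unitarymx // trmxC_unitary spectral_unitarymx.
have -> : U *m A *m U^t* = W *m diag_mx (spectral_diag A) *m W^t*.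
  rewrite {1}(orthomx_spectralP An) invmx_unitary ?spectral_unitarymx //.
  by rewrite /W trmx_mul map_mxM trmxCK !mulmxA.
have entry j : `|(W *m diag_mx (spectral_diag A) *m W^t*) j j| <=
    \sum_i `|W j i| ^+ 2 * `|spectral_diag A 0 i|.
  rewrite mxE (le_trans (ler_norm_sum _ _ _)) // ler_sum // => i _.
  by rewrite mul_mx_diag !mxE !normrM norm_conjC mulrAC -expr2.
rewrite (le_trans (ler_sum _ (fun j _ => entry j))) // exchange_big /=.
rewrite le_eqVlt; apply/orP; left; apply/eqP; apply: eq_bigr => i _.
by rewrite -mulr_suml (unitary_col _ Wu) mul1r.
Qed.

Lemma diag_spectral n (A : 'M[C]_n) i : A \is normalmx ->
  (spectralmx A *m A *m (spectralmx A)^t*) i i = spectral_diag A 0 i.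
Proof.
move=> An; have Pu := spectral_unitarymx A.
rewrite {2}(orthomx_spectralP An) invmx_unitary // !mulmxA.
by rewrite (unitarymxP Pu) mul1mx mulmxtVK // mxE eqxx mulr1n.
Qed.

(** Test [diag_conj_le] on the direct sum of eigenbases of the two diagonal
    blocks: the diagonal is then the union of the two spectra. *)
Lemma nuclear_block n1 n2 (A1 : 'M[C]_n1) (A2 : 'M[C]_n2) B B' :
  A1 \is normalmx -> A2 \is normalmx -> block_mx A1 B B' A2 \is normalmx ->
  nuclear A1 + nuclear A2 <= nuclear (block_mx A1 B B' A2).
Proof.
move=> n_1 n_2 n_; pose P1 := spectralmx A1; pose P2 := spectralmx A2.
have Uu : block_mx P1 0 0 P2 \is unitarymx.
  apply/unitarymxP; rewrite tr_block_mx map_block_mx mulmx_block.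
  rewrite !(trmx0, map_mx0, mulmx0, mul0mx, addr0, add0r).
  by rewrite !(unitarymxP (spectral_unitarymx _)) -scalar_mx_block.
apply: le_trans (diag_conj_le n_ Uu).
rewrite tr_block_mx map_block_mx !mulmx_block.
rewrite !(trmx0, map_mx0, mulmx0, mul0mx, addr0, add0r).
rewrite big_split_ord /= le_eqVlt; apply/orP; left; apply/eqP.
by congr (_ + _); apply: eq_bigr => i _;
  rewrite ?block_mxEul ?block_mxEdr diag_spectral.
Qed.

Lemma nuclear_conj n (A S : 'M[C]_n) : A \is normalmx -> S \is unitarymx ->
  S *m A *m S^t* \is normalmx -> nuclear (S *m A *m S^t*) <= nuclear A.
Proof.
move=> An Su Bn; set B := S *m A *m S^t*.
have Uu : spectralmx B *m S \is unitarymx.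
  by rewrite mul_unitarymx // spectral_unitarymx.
apply: le_trans (diag_conj_le An Uu).
rewrite le_eqVlt; apply/orP; left; apply/eqP; apply: eq_bigr => i _.
rewrite -(diag_spectral _ Bn) /B; congr `|fun_of_matrix _ _ _|.
by rewrite trmx_mul map_mxM !mulmxA.
Qed.

(** An equality, stated as an inequality because that is all that follows at
    once from [diag_conj_le]; the inverse bijection gives the converse. *)
Lemma nuclear_reindex m n (A : 'M[C]_n) (B : 'M[C]_m) (f : 'I_m -> 'I_n) :
  A \is normalmx -> B \is normalmx -> bijective f ->
  (forall i j, B i j = A (f i) (f j)) -> nuclear B <= nuclear A.
Proof.
move=> An Bn f_bij eqB; have mn : m = n.
  by have := bij_eq_card f_bij; rewrite !card_ord.
case: n / mn A f An f_bij eqB => A f An /bij_inj f_inj eqB.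
have defB : B = perm_mx (perm f_inj) *m A *m (perm_mx (perm f_inj))^t*.
  apply/matrixP=> i j; rewrite -row_permE tr_perm_mx map_perm_mx.
  by rewrite -col_permE !mxE !permE eqB.
rewrite defB nuclear_conj // -?defB //.
by apply/unitarymxP; rewrite tr_perm_mx map_perm_mx -perm_mxM mulgV perm_mx1.
Qed.
End NuclearNorm.

(** * The energy of a relation along a sequence of points *)

Section RelationEnergy.
Local Open Scope ring_scope.
Variable C : numClosedFieldType.

(** Indexing by a sequence of points, rather than by a subset, makes the
    concatenation of sequences correspond to a block decomposition. *)
Definition relmx (V : Type) (a : rel V) (xs : seq V) : 'M[C]_(size xs) :=
  \matrix_(i, j) (a (tnth (in_tuple xs) i) (tnth (in_tuple xs) j))%:R.

Lemma real_sym_hermitian n (A : 'M[C]_n) :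
  (forall i j, A i j \is Num.real) -> (forall i j, A i j = A j i) -> A \is hermsymmx.
Proof.
move=> Areal Asym; apply: realsym_hermsym.
  apply/is_hermitianmxP; rewrite expr0 scale1r map_mx_id //.
  by apply/matrixP => i j; rewrite mxE.
by apply/mxOverP.
Qed.

Lemma relmx_herm (V : Type) (a : rel V) xs : symmetric a ->
  relmx a xs \is hermsymmx.
Proof.
move=> a_sym; apply: real_sym_hermitian => i j; rewrite !mxE ?realn //.
by rewrite a_sym.
Qed.

Definition rel_energy (V : Type) (a : rel V) (xs : seq V) : C := nuclear (relmx a xs).

Lemma rel_energy_le_adjmx (G : sgraph) (xs : seq G) :
  uniq xs -> (forall x, x \in xs) -> rel_energy (@adj G) xs <= nuclear (adjmx C G).
Proof.
move=> xs_uniq xs_all.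
have f_inj : injective (fun i => enum_rank (tnth (in_tuple xs) i)).
  move=> i j /enum_rank_inj /tuple_uniqP; exact.
have f_bij : bijective (fun i => enum_rank (tnth (in_tuple xs) i)).
  apply: inj_card_bij => //; rewrite !card_ord -(card_uniqP xs_uniq).
  by apply: subset_leq_card; apply/subsetP => x _; exact: xs_all.
apply: nuclear_reindex f_bij _.
- by apply/hermitian_normalmx/real_sym_hermitian => i j; rewrite !mxE ?realn // adj_sym.
- exact/hermitian_normalmx/relmx_herm/adj_sym.
- by move=> i j; rewrite !mxE !enum_rankK.
Qed.

Lemma rel_energy_perm (V : eqType) (a : rel V) xs ys : symmetric a ->
  perm_eq xs ys -> rel_energy a xs <= rel_energy a ys.
Proof.
move=> a_sym /[dup] /perm_size sz.
have -> : xs = in_tuple xs by [].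
rewrite perm_sym; case/tuple_permP => p defy.
have n_ zs := hermitian_normalmx (relmx_herm zs a_sym).
pose f (i : 'I_(size xs)) : 'I_(size ys) := cast_ord sz ((p^-1)%g i).
apply: (@nuclear_reindex _ _ _ _ _ f) => //.
  by apply: inj_card_bij => [i j /cast_ord_inj /perm_inj|]; rewrite // !card_ord sz.
move=> i j; rewrite !mxE /=.
suff E k : tnth (in_tuple ys) (f k) = tnth (in_tuple xs) k by rewrite !E.
rewrite (tnth_nth (tnth (in_tuple xs) k)) /= {1}defy.
by rewrite (nth_map k) ?size_enum_ord ?ltn_ord // nth_ord_enum permKV.
Qed.

Lemma rel_energy_cat (V : eqType) (a : rel V) xs ys : symmetric a ->
  rel_energy a xs + rel_energy a ys <= rel_energy a (xs ++ ys).
Proof.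
move=> a_sym; have n_ zs := hermitian_normalmx (relmx_herm zs a_sym).
pose e : 'I_(size xs + size ys) -> 'I_(size (xs ++ ys)) :=
  cast_ord (esym (size_cat xs ys)).
pose M := \matrix_(i, j) relmx a (xs ++ ys) (e i) (e j).
have el i : tnth (in_tuple (xs ++ ys)) (e (lshift _ i)) = tnth (in_tuple xs) i.
  by have x0 := tnth (in_tuple xs) i; rewrite !(tnth_nth x0) /= nth_cat ltn_ord.
have er i : tnth (in_tuple (xs ++ ys)) (e (rshift _ i)) = tnth (in_tuple ys) i.
  have x0 := tnth (in_tuple ys) i; rewrite !(tnth_nth x0) /= nth_cat.
  by rewrite ltnNge leq_addr addKn.
have defM : M = block_mx (relmx a xs) (ursubmx M) (dlsubmx M) (relmx a ys).
  rewrite -[LHS]submxK; congr block_mx; apply/matrixP=> i j;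
  by rewrite !mxE ?el ?er.
have nM : M \is normalmx.
  apply/hermitian_normalmx/real_sym_hermitian => i j; rewrite !mxE ?realn //.
  by rewrite a_sym.
have leM : nuclear M <= rel_energy a (xs ++ ys).
  apply: (@nuclear_reindex _ _ _ _ _ e) => //.
    by apply: inj_card_bij => [i j /cast_ord_inj|]; rewrite // !card_ord size_cat.
  by move=> i j; rewrite mxE.
apply: le_trans leM; rewrite defM nuclear_block -?defM //; exact: n_.
Qed.
End RelationEnergy.

Section RealEnergy.
Local Open Scope ring_scope.
Local Open Scope complex_scope.
Variable R : rcfType.
Local Notation C := R[i].
Lemma norm_real_complex (x : R) : `|x%:C| = `|x|%:C.
Proof. by rewrite normc_def /= expr0n addr0 sqrtr_sqr. Qed.

Lemma nuclear_adjmx (G : sgraph) : nuclear (adjmx C G) = (energy R G)%:C.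
Proof.
set B := adjmx C G.
have Bh : B \is hermsymmx.
  apply: real_sym_hermitian => i j; rewrite !mxE ?realn //.
  by rewrite adj_sym.
pose toC := @real_complex_def R (Phant R).
have chB : char_poly B = \prod_(i < #|G|) ('X - (spectral_diag B 0 i)%:P).
  have /orthomx_spectralP Beq := hermitian_normalmx Bh.
  by rewrite {1}Beq char_poly_similar ?spectral_unit // char_poly_diag.
have defB : B = map_mx toC (adjmx R G).
  by apply/matrixP=> i j; rewrite !mxE [RHS](rmorph_nat (real_complex R)).
have := chB; rewrite {1}defB -map_char_poly char_poly_adjmx rmorph_prod /=.
under eq_bigr do rewrite rmorphB /= map_polyX map_polyC.
rewrite -(big_map toC xpredT (fun x => 'X - x%:P)).
rewrite -[RHS](big_map (spectral_diag B 0) xpredT (fun x => 'X - x%:P)).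
move=> /prod_XsubC_eq eqs.
rewrite /nuclear /energy rmorph_sum /=.
rewrite -(big_map (spectral_diag B 0) xpredT Num.norm) -(perm_big _ eqs) big_map.
by apply: eq_bigr => x _; rewrite norm_real_complex.
Qed.

End RealEnergy.

(** * Closed walks bound the energy from below *)

Section Traces.
Local Open Scope ring_scope.
Variable C : numClosedFieldType.

Lemma trace_exp n (A : 'M[C]_n) m : A \is normalmx ->
  \tr (A ^+ m) = \sum_i spectral_diag A 0 i ^+ m.
Proof.
move=> An; set P := spectralmx A; set D := diag_mx (spectral_diag A).
have PV : P *m invmx P = 1%:M by rewrite mulmxV ?spectral_unit.
have expA : A ^+ m = invmx P *m diag_mx (\row_i spectral_diag A 0 i ^+ m) *m P.
  elim: m => [|m IHm].
    have -> : diag_mx (\row_i spectral_diag A 0 i ^+ 0) = 1%:M.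
      by rewrite -diag_const_mx; congr diag_mx; apply/rowP=> i; rewrite !mxE.
    by rewrite mulmx1 mulVmx ?spectral_unit.
  have defA : A = invmx P *m D *m P := orthomx_spectralP An.
  have mulE (X Y : 'M[C]_n) : X * Y = X *m Y by [].
  rewrite exprS IHm mulE {1}defA !mulmxA -(mulmxA _ P) PV mulmx1.
  rewrite -(mulmxA _ D) mulmx_diag; congr (_ *m diag_mx _ *m _).
  by apply/rowP=> i; rewrite !mxE exprS.
rewrite expA mxtrace_mulC mulmxA PV mul1mx mxtrace_diag.
by apply: eq_bigr => i _; rewrite mxE.
Qed.

Lemma nuclear_ge_traces n (A : 'M[C]_n) : A \is hermsymmx ->
  1624 * \tr (A ^+ 2) + 565 * \tr (A ^+ 6) + 19 * \tr (A ^+ 10) <=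
  864 * nuclear A + 1198 * \tr (A ^+ 4) + 145 * \tr (A ^+ 8) + \tr (A ^+ 12).
Proof.
move=> Ah; have An := hermitian_normalmx Ah.
rewrite (trace_exp 2 An) (trace_exp 4 An) (trace_exp 6 An).
rewrite (trace_exp 8 An) (trace_exp 10 An) (trace_exp 12 An).
rewrite /nuclear !mulr_sumr -!big_split /=.
apply: ler_sum => i _.
have /mxOverP/(_ 0 i) := hermitian_spectral_diag_real Ah.
exact: norm_ge_minorant.
Qed.
End Traces.

Local Notation N := BinNums.N.
Local Notation "m +! n" := (BinNat.N.add m n) (at level 50, left associativity).
Local Notation "m *! n" := (BinNat.N.mul m n) (at level 40, left associativity).
Local Notation toN := BinNat.N.of_nat.
Local Notation ofN := BinNat.N.to_nat.

Definition neighbours (a : rel nat) n : seq (seq nat) :=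
  [seq [seq j <- iota 0 n | a i j] | i <- iota 0 n].

Definition Nsum (T : Type) (f : T -> N) (s : seq T) : N :=
  foldr (fun x m => f x +! m) BinNums.N0 s.

Definition walk_step (nb : seq (seq nat)) (v : seq N) : seq N :=
  [seq Nsum (nth BinNums.N0 v) l | l <- nb].

Definition walk_vector nb n i k : seq N :=
  iter k (walk_step nb) [seq toN (i == j) | j <- iota 0 n].

(** The number of closed walks of length 2k, computed as the squared norm of the
    k-th power of the adjacency matrix. *)
Definition half_moment nb n k : N :=
  Nsum (fun i => Nsum (fun x => x *! x) (walk_vector nb n i k))
       (iota 0 n).

(** The integer form of the inequality n <= tr p(A), with p the minorant of
    [norm_ge_minorant]; it is stated in binary so that it can be evaluated. *)
Definition certified (a : rel nat) n : bool :=
  let m := half_moment (neighbours a n) n in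
  BinNat.N.leb
    (toN 864 *! toN n +! toN 1198 *! m 2 +! toN 145 *! m 4 +! m 6)
    (toN 1624 *! m 1 +! toN 565 *! m 3 +! toN 19 *! m 5).

Lemma ofND x y : ofN (x +! y) = ofN x + ofN y.
Proof. by rewrite Nnat.N2Nat.inj_add plusE. Qed.

Lemma ofNM x y : ofN (x *! y) = ofN x * ofN y.
Proof. by rewrite Nnat.N2Nat.inj_mul multE. Qed.

Lemma ofN_sum (T : Type) (f : T -> N) s : ofN (Nsum f s) = \sum_(x <- s) ofN (f x).
Proof. by elim: s => [|x s IHs]; rewrite ?big_nil // big_cons ofND IHs. Qed.

Lemma ofN_leb (x y : N) : BinNat.N.leb x y -> ofN x <= ofN y.
Proof.
move=> /BinNat.N.leb_le le_xy.
by rewrite -(BinNat.N.sub_add _ _ le_xy) ofND leq_addl.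
Qed.

Section Soundness.
Variables (a : rel nat) (n : nat).
Local Notation nb := (neighbours a n).
Local Notation w := (walk_vector nb n).

Lemma size_walk_vector i k : size (w i k) = n.
Proof. by case: k => [|k]; rewrite /= !size_map size_iota. Qed.

Lemma walk_vector0 i j : j < n -> ofN (nth BinNums.N0 (w i 0) j) = (i == j).
Proof.
move=> lt_jn; rewrite (nth_map 0) ?size_iota // nth_iota // add0n.
by case: eqP.
Qed.

Lemma walk_vectorS i k j : j < n ->
  ofN (nth BinNums.N0 (w i k.+1) j) =
  \sum_(l < n | a j l) ofN (nth BinNums.N0 (w i k) l).
Proof.
move=> lt_jn; rewrite /= (nth_map [::]) ?size_map ?size_iota //.
rewrite (nth_map 0) ?size_iota // nth_iota // add0n ofN_sum big_filter.
by rewrite -(big_mkord (a j) (fun l => ofN (nth BinNums.N0 (w i k) l))) /index_iota subn0.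
Qed.

Section Matrix.
Local Open Scope ring_scope.
Variables (F : numClosedFieldType) (A : 'M[F]_n).
Hypothesis A_def : forall i j, A i j = (a i j)%:R.
Hypothesis A_sym : forall i j, A i j = A j i.

Lemma expmx_walk k i j : (A ^+ k) j i = (ofN (nth BinNums.N0 (w i k) j))%:R.
Proof.
elim: k j => [|k IHk] j.
  by rewrite expr0 mxE walk_vector0 // -val_eqE /= eq_sym.
rewrite exprS mxE walk_vectorS // natr_sum [RHS]big_mkcond /=.
by apply: eq_bigr => l _; rewrite A_def IHk; case: (a j l); rewrite ?mul1r ?mul0r.
Qed.

Lemma expmx_sym k i j : (A ^+ k) i j = (A ^+ k) j i.
Proof.
have At : A^T = A by apply/matrixP=> x y; rewrite mxE.
have AkT : (A ^+ k)^T = A ^+ k.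
  elim: k => [|k IHk]; first by rewrite expr0 trmx1.
  by rewrite {1}exprSr trmx_mul At IHk exprS.
by rewrite -[in LHS]AkT mxE.
Qed.

Lemma trace_half_moment k : \tr (A ^+ k.*2) = (ofN (half_moment nb n k))%:R.
Proof.
have iotaE : iota 0 n = index_iota 0 n by rewrite /index_iota subn0.
rewrite ofN_sum iotaE big_mkord natr_sum.
rewrite -addnn exprD; apply: eq_bigr => i _; rewrite mxE.
rewrite ofN_sum (big_nth BinNums.N0) size_walk_vector big_mkord natr_sum.
apply: eq_bigr => j _.
by rewrite (expmx_sym k i j) expmx_walk ofNM natrM.
Qed.

Lemma certified_nuclear : certified a n -> n%:R <= nuclear A.
Proof.
have Ah : A \is hermsymmx.
  by apply: real_sym_hermitian => // i j; rewrite A_def realn.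
(* The weights are variables here so that no unary numeral gets unfolded. *)
have cast (c0 c1 c2 c3 c4 c5 : nat) m1 m2 m3 m4 m5 m6 :
    BinNat.N.leb (toN c0 *! toN n +! toN c2 *! m2 +! toN c4 *! m4 +! m6)
                 (toN c1 *! m1 +! toN c3 *! m3 +! toN c5 *! m5) ->
    c0%:R * n%:R + c2%:R * (ofN m2)%:R + c4%:R * (ofN m4)%:R + (ofN m6)%:R <=
    c1%:R * (ofN m1)%:R + c3%:R * (ofN m3)%:R + c5%:R * (ofN m5)%:R :> F.
  move=> /ofN_leb; rewrite !ofND !ofNM !Nnat.Nat2N.id -(ler_nat F).
  by rewrite !natrD !natrM.
move=> /cast; rewrite -!trace_half_moment => le_m.
have := le_trans le_m (nuclear_ge_traces Ah).
by rewrite !lerD2r ler_pM2l.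
Qed.
End Matrix.
End Soundness.

(** * Labelled binary trees *)

Inductive btree (V : Type) := Empty | Node of V & btree V & btree V.
Arguments Empty {V}.

Section Structure.
Variable V : Type.
Implicit Types t l r : btree V.

Fixpoint labels t : seq V :=
  if t is Node v l r then v :: labels l ++ labels r else [::].

Definition nnodes t := size (labels t).

(** Putting the larger branch first gives each rooted exceptional tree a single
    normal form, because its sibling branches of equal size have the same shape. *)
Definition heavy_first v l r :=
  if nnodes l < nnodes r then Node v r l else Node v l r.

Fixpoint normalise t :=
  if t is Node v l r then heavy_first v (normalise l) (normalise r) else Empty.

Lemma nnodes_node v l r : nnodes (Node v l r) = (nnodes l + nnodes r).+1.
Proof. by rewrite /nnodes /= size_cat. Qed.

Lemma nnodes_heavy_first v l r : nnodes (heavy_first v l r) = (nnodes l + nnodes r).+1.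
Proof. by rewrite /heavy_first; case: ifP; rewrite nnodes_node // addnC. Qed.

Lemma nnodes_normalise t : nnodes (normalise t) = nnodes t.
Proof. by elim: t => //= v l IHl r IHr; rewrite nnodes_heavy_first IHl IHr nnodes_node. Qed.

Lemma nnodes0 t : nnodes t = 0 -> t = Empty.
Proof. by case: t. Qed.

End Structure.

Fixpoint same_shape (V W : Type) (t : btree V) (s : btree W) : bool :=
  match t, s with
  | Empty, Empty => true
  | Node _ l r, Node _ l' r' => same_shape l l' && same_shape r r'
  | _, _ => false
  end.

Lemma same_shapeP : Equality.axiom (@same_shape unit unit).
Proof.
elim=> [|[] l IHl r IHr] [|[] l' r'] /=; try by constructor.
by apply: (iffP andP) => [[/IHl-> /IHr->]|[<- <-]]; last by split; [apply/IHl|apply/IHr].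
Qed.

HB.instance Definition _ := hasDecEq.Build (btree unit) same_shapeP.

Fixpoint relabel (V W : Type) (f : V -> W) (t : btree V) : btree W :=
  if t is Node v l r then Node (f v) (relabel f l) (relabel f r) else Empty.

Fixpoint preorder (W : Type) (k : nat) (s : btree W) : btree nat :=
  if s is Node _ l r then Node k (preorder k.+1 l) (preorder (k.+1 + nnodes l) r)
  else Empty.

(** The rootings of the four excluded trees at a vertex of degree at most 2, in
    normal form.  The empty tree stands for an absent branch. *)
Definition exceptional_shapes : seq (btree unit) :=
  let leaf := Node tt Empty Empty in
  let cherry := Node tt leaf leaf in
  let claw := Node tt cherry Empty in
  [:: Empty; leaf; cherry; Node tt (Node tt leaf Empty) Empty; claw;
      Node tt cherry cherry; Node tt (Node tt claw leaf) Empty].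

Definition normal_exceptional (V : Type) (t : btree V) := has (same_shape t) exceptional_shapes.
Definition exceptional (V : Type) (t : btree V) := normal_exceptional (normalise t).

Section Shape.
Variables V W : Type.
Lemma same_shape_nnodes (t : btree V) (s : btree W) : same_shape t s -> nnodes t = nnodes s.
Proof.
elim: t s => [|v l IHl r IHr] [|w l' r'] //= /andP[/IHl El /IHr Er].
by rewrite !nnodes_node El Er.
Qed.

Lemma same_shape_trans (U : Type) (t : btree V) (s : btree W) (p : btree U) :
  same_shape t s -> same_shape t p = same_shape s p.
Proof.
elim: t s p => [|v l IHl r IHr] [|w l' r'] // [|p l'' r''] //=.
by move=> /andP[/IHl-> /IHr->].
Qed.

Lemma same_shape_normal_exceptional (t : btree V) (s : btree W) : same_shape t s -> normal_exceptional t = normal_exceptional s.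
Proof. by move=> ts; apply: eq_has => p; apply: same_shape_trans. Qed.

Lemma same_shape_heavy_first (v : V) (w : W) (l r : btree V) (l' r' : btree W) :
  same_shape l l' -> same_shape r r' ->
  same_shape (heavy_first v l r) (heavy_first w l' r').
Proof.
move=> ll' rr'; rewrite /heavy_first (same_shape_nnodes ll') (same_shape_nnodes rr').
by case: ifP => _ /=; rewrite ll' rr'.
Qed.

Lemma labels_preorder k (s : btree W) : labels (preorder k s) = iota k (nnodes s).
Proof.
elim: s k => [//|w l IHl r IHr] k.
by rewrite nnodes_node /= IHl IHr -iotaD.
Qed.

(** A labelled tree is recovered from its shape and the list of its labels; this
    transfers computations on shapes to arbitrary labels. *)
Lemma relabel_preorder x0 (xs : seq V) k (t : btree V) (s : btree W) : same_shape t s ->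
  (forall i, i < nnodes t -> nth x0 xs (k + i) = nth x0 (labels t) i) ->
  relabel (nth x0 xs) (preorder k s) = t.
Proof.
elim: t s k => [|v l IHl r IHr] [|w l' r'] //= k /andP[ll' rr'] nthE.
have := nthE 0 isT; rewrite addn0 /= => ->.
rewrite (IHl l' k.+1) ?(IHr r') //.
  move=> i lt_i; rewrite -(same_shape_nnodes ll') addSnnS -addnA addSn.
  by rewrite nthE ?nnodes_node ?ltnS ?ltn_add2l //= nth_cat ltnNge leq_addr addKn.
move=> i lt_i; rewrite addSnnS nthE ?nnodes_node ?ltnS ?ltn_addr //.
  by rewrite /= nth_cat lt_i.
Qed.
End Shape.

Section Adjacency.
Variable V : eqType.
Implicit Types t l r u w : btree V.

Definition is_root t x := if t is Node v _ _ then x == v else false.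

Fixpoint tree_adj t x y : bool :=
  if t is Node v l r then
    [|| (x == v) && (is_root l y || is_root r y),
        (y == v) && (is_root l x || is_root r x), tree_adj l x y | tree_adj r x y]
  else false.

(** Adjacency in the tree obtained from two rooted trees by joining their roots
    by an edge. *)
Definition join_adj u w x y :=
  [|| is_root u x && is_root w y, is_root w x && is_root u y,
      tree_adj u x y | tree_adj w x y].

Lemma is_root_labels t x : is_root t x -> x \in labels t.
Proof. by case: t => //= v l r /eqP->; rewrite mem_head. Qed.

Lemma tree_adj_sym t : symmetric (tree_adj t).
Proof. by elim: t => //= v l IHl r IHr x y; rewrite IHl IHr orbCA. Qed.

Lemma tree_adj_labels t x y : tree_adj t x y -> x \in labels t.
Proof.
elim: t => //= v l IHl r IHr; rewrite inE mem_cat.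
case/or4P => [/andP[->]//|/andP[_ /orP[]/is_root_labels->]|/IHl->|/IHr->];
by rewrite ?orbT.
Qed.

Lemma join_adjC u w x y : join_adj u w x y = join_adj w u x y.
Proof. by rewrite /join_adj orbCA [tree_adj w x y || _]orbC. Qed.

(** Moving the distinguished edge one step down to the left: the vertex v now
    belongs to the other side, of which it becomes the root. *)
Lemma join_adj_left v l r w x y : join_adj (Node v l r) w x y = join_adj l (Node v r w) x y.
Proof.
rewrite /join_adj /=; move: (is_root l x) (is_root l y) (is_root r x) (is_root r y).
move: (is_root w x) (is_root w y) (tree_adj l x y) (tree_adj r x y) (tree_adj w x y).
by case: (x == v); case: (y == v); do 9!case.
Qed.

Lemma join_adj_right v l r w x y : join_adj (Node v l r) w x y = join_adj r (Node v l w) x y.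
Proof.
rewrite /join_adj /=; move: (is_root l x) (is_root l y) (is_root r x) (is_root r y).
move: (is_root w x) (is_root w y) (tree_adj l x y) (tree_adj r x y) (tree_adj w x y).
by case: (x == v); case: (y == v); do 9!case.
Qed.

Lemma is_root_normalise t x : is_root (normalise t) x = is_root t x.
Proof. by case: t => //= v l r; rewrite /heavy_first; case: ifP. Qed.

Lemma tree_adj_normalise t x y : tree_adj (normalise t) x y = tree_adj t x y.
Proof.
elim: t => //= v l IHl r IHr; rewrite -IHl -IHr -!(is_root_normalise l).
rewrite -!(is_root_normalise r) /heavy_first; case: ifP => //= _.
by rewrite [tree_adj (normalise r) _ _ || _]orbC ![is_root (normalise r) _ || _]orbC.
Qed.

Lemma labels_normalise t : perm_eq (labels (normalise t)) (labels t).
Proof.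
elim: t => //= v l IHl r IHr; rewrite /heavy_first; case: ifP => _ /=;
  rewrite perm_cons; last exact: perm_cat.
by rewrite perm_catC perm_cat.
Qed.

Lemma join_adj_normalise u w x y :
  join_adj (normalise u) (normalise w) x y = join_adj u w x y.
Proof. by rewrite /join_adj !is_root_normalise !tree_adj_normalise. Qed.
End Adjacency.

Section Relabel.
Variables (V W : eqType) (f : V -> W) (D : pred V).
Hypothesis f_inj : {in D &, injective f}.
Implicit Types t : btree V.

Lemma is_root_relabel t x : {subset labels t <= D} -> x \in D ->
  is_root (relabel f t) (f x) = is_root t x.
Proof.
case: t => //= v l r tD xD; apply: (inj_in_eq f_inj) => //.
by apply: tD; rewrite mem_head.
Qed.

Lemma tree_adj_relabel t x y : {subset labels t <= D} -> x \in D -> y \in D ->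
  tree_adj (relabel f t) (f x) (f y) = tree_adj t x y.
Proof.
move=> + xD yD; elim: t => //= v l IHl r IHr tD.
have vD : v \in D by apply: tD; rewrite mem_head.
have lD : {subset labels l <= D}.
  by move=> z zl; apply: tD; rewrite inE mem_cat zl orbT.
have rD : {subset labels r <= D}.
  by move=> z zr; apply: tD; rewrite inE mem_cat zr !orbT.
by rewrite IHl ?IHr // !is_root_relabel // !(inj_in_eq f_inj).
Qed.
End Relabel.

(** * Decomposition of binary trees *)

Definition certified_join (u w : btree unit) : bool :=
  certified (join_adj (preorder 0 u) (preorder (nnodes u) w)) (nnodes u + nnodes w).

(** The second alternative concerns a tree in which w is the single root above u:
    it may be exceptional as a whole although u is not. *)
Definition settled (l r w : btree unit) : bool :=
  let u := heavy_first tt l r in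
  [|| normal_exceptional u, (nnodes w == 1) && normal_exceptional (Node tt u Empty)
    | certified_join (Node tt l r) w].

Lemma all_settled :
  all (fun l => all (fun r => all (settled l r) exceptional_shapes)
    exceptional_shapes) exceptional_shapes.
Proof. by vm_compute. Qed.

Section Decomposition.
Variables (V : eqType) (a : rel V) (C : numClosedFieldType).
Hypothesis a_sym : symmetric a.
Implicit Types t l r u w : btree V.

Definition embedded t :=
  uniq (labels t) /\ {in labels t &, a =2 tree_adj t}.

Definition join_embedded u w :=
  uniq (labels u ++ labels w) /\ {in labels u ++ labels w &, a =2 join_adj u w}.

Lemma embedded_join t : embedded t -> join_embedded t Empty.
Proof.
by rewrite /join_embedded cats0 => -[t_uniq aE]; split=> // x y xt yt;
  rewrite aE // /join_adj /= andbF orbF.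
Qed.

(** Each side of an edge of a tree is an induced subgraph. *)
Lemma join_embedded_left u w : join_embedded u w -> embedded u.
Proof.
rewrite /join_embedded cat_uniq => -[/and3P[u_uniq /hasPn dis w_uniq] aE].
split=> // x y xu yu; rewrite aE ?mem_cat ?xu ?yu // /join_adj.
have disj z : z \in labels u -> z \notin labels w.
  by move=> zu; apply/negP=> /dis; rewrite /= zu.
rewrite (contraNF (@is_root_labels _ _ _) (disj _ yu)) andbF.
rewrite (contraNF (@is_root_labels _ _ _) (disj _ xu)) /=.
by rewrite (contraNF (@tree_adj_labels _ _ _ _) (disj _ xu)) orbF.
Qed.

Lemma join_embedded_perm u w u' w' :
  perm_eq (labels u ++ labels w) (labels u' ++ labels w') ->
  join_adj u w =2 join_adj u' w' -> join_embedded u w -> join_embedded u' w'.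
Proof.
move=> eq_lab eq_adj [uw_uniq aE]; split; first by rewrite -(perm_uniq eq_lab).
by move=> x y; rewrite -!(perm_mem eq_lab) -eq_adj; apply: aE.
Qed.

Lemma join_embeddedC u w : join_embedded u w -> join_embedded w u.
Proof. by apply: join_embedded_perm => [|x y]; [rewrite perm_catC | rewrite join_adjC]. Qed.

Lemma labels_left v l r w :
  perm_eq (labels (Node v l r) ++ labels w) (labels l ++ labels (Node v r w)).
Proof. by apply/seq.permP=> p; rewrite /= !count_cat /= !count_cat; lia. Qed.

Lemma labels_right v l r w :
  perm_eq (labels (Node v l r) ++ labels w) (labels r ++ labels (Node v l w)).
Proof. by apply/seq.permP=> p; rewrite /= !count_cat /= !count_cat; lia. Qed.

Lemma exceptional_single v t : exceptional (Node v t Empty) = normal_exceptional (Node v (normalise t) Empty).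
Proof. by rewrite /exceptional /= /heavy_first ltn0. Qed.

Lemma exceptionalP t : exceptional t ->
  exists2 s, s \in exceptional_shapes & same_shape (normalise t) s.
Proof. by rewrite /exceptional /normal_exceptional => /hasP. Qed.

(** When w is a single vertex, joining it to u gives back the tree in which the
    descent started, up to the order of the branches; this keeps track of the fact
    that it is not exceptional. *)
Definition rooted_apart u w :=
  forall v, nnodes w = 1 -> ~~ exceptional (Node v u Empty).

(** Follow non-exceptional branches downwards.  The part left behind, seen from
    the current subtree, is again a binary tree. *)
Lemma descend u w : ~~ exceptional u -> rooted_apart u w ->
  exists v l r w',
    [/\ perm_eq (labels u ++ labels w) (labels (Node v l r) ++ labels w')
          /\ join_adj u w =2 join_adj (Node v l r) w',
        ~~ exceptional (Node v l r), exceptional l, exceptional r & rooted_apart (Node v l r) w'].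
Proof.
elim: u w => // v l IHl r IHr w nexc apart.
have [excl|nexcl] := boolP (exceptional l); last first.
  have [|v' [l' [r' [w' [[pw jw] H]]]]] := IHl (Node v r w) nexcl.
    move=> p; rewrite nnodes_node => -[/eqP]; rewrite addn_eq0.
    case/andP=> /eqP/nnodes0 r0 _; move: nexc; rewrite r0.
    by rewrite !exceptional_single.
  exists v', l', r', w'; split=> //; split.
    exact: perm_trans (labels_left _ _ _ _) pw.
  by move=> x y; rewrite join_adj_left jw.
have [excr|nexcr] := boolP (exceptional r); last first.
  have [|v' [l' [r' [w' [[pw jw] H]]]]] := IHr (Node v l w) nexcr.
    move=> p; rewrite nnodes_node => -[/eqP]; rewrite addn_eq0.
    case/andP=> /eqP/nnodes0 l0 _; move: nexc; rewrite l0 exceptional_single.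
    rewrite /exceptional /= /heavy_first nnodes_normalise.
    by case: (r) nexcr => // v' l' r'; rewrite nnodes_node.
  exists v', l', r', w'; split=> //; split.
    exact: perm_trans (labels_right _ _ _ _) pw.
  by move=> x y; rewrite join_adj_right jw.
by exists v, l, r, w; split.
Qed.

Lemma certified_join_energy u w (u' w' : btree unit) :
  same_shape u u' -> same_shape w w' -> join_embedded u w ->
  certified_join u' w' ->
  ((size (labels u ++ labels w))%:R <= rel_energy C a (labels u ++ labels w))%R.
Proof.
move=> su sw; set xs := labels u ++ labels w => -[xs_uniq aE].
have sz : nnodes u' + nnodes w' = size xs.
  by rewrite -(same_shape_nnodes su) -(same_shape_nnodes sw) size_cat.
rewrite /certified_join sz; apply: certified_nuclear; last first.
  by move=> i j; rewrite !mxE a_sym.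
move=> i j; rewrite mxE; congr (nat_of_bool _)%:R%R.
have x0 := tnth (in_tuple xs) i.
rewrite !(tnth_nth x0) /= aE ?mem_nth //.
have ru : relabel (nth x0 xs) (preorder 0 u') = u.
  by apply: relabel_preorder => // k lt_k; rewrite nth_cat lt_k.
have rw : relabel (nth x0 xs) (preorder (nnodes u') w') = w.
  apply: relabel_preorder => // k lt_k.
  by rewrite nth_cat -(same_shape_nnodes su) ltnNge leq_addr addKn.
have f_inj : {in (fun k => k < size xs) &, injective (nth x0 xs)}.
  by move=> k m lt_k lt_m /eqP; rewrite nth_uniq // => /eqP.
have uD : {subset labels (preorder 0 u') <= (fun k => k < size xs)}.
  by move=> k; rewrite labels_preorder mem_iota -sz /in_mem /=; lia.
have wD : {subset labels (preorder (nnodes u') w') <= (fun k => k < size xs)}.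
  by move=> k; rewrite labels_preorder mem_iota -sz /in_mem /=; lia.
rewrite -{1}ru -{1}rw /join_adj.
by rewrite !(is_root_relabel f_inj) ?(tree_adj_relabel f_inj) //; apply: ltn_ord.
Qed.

(** Normalising the three branches changes neither the labels nor the adjacency,
    and leaves only the shapes enumerated in [all_settled]. *)
Lemma settled_join_energy v l r w : join_embedded (Node v l r) w ->
  ~~ exceptional (Node v l r) -> rooted_apart (Node v l r) w ->
  exceptional l -> exceptional r -> exceptional w ->
  ((size (labels (Node v l r) ++ labels w))%:R <=
    rel_energy C a (labels (Node v l r) ++ labels w))%R.
Proof.
set xs := labels (Node v l r) ++ labels w.
move=> emb nexc apart /exceptionalP[l' l'S ll'] /exceptionalP[r' r'S rr'] /exceptionalP[w' w'S ww'].
have := all_settled => /allP/(_ _ l'S)/allP/(_ _ r'S)/allP/(_ _ w'S).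
have shf := same_shape_heavy_first v tt ll' rr'.
have nexc' : normal_exceptional (heavy_first v (normalise l) (normalise r)) = false.
  exact: negbTE nexc.
rewrite /settled -(same_shape_normal_exceptional shf) nexc' /=.
rewrite -(same_shape_nnodes ww') nnodes_normalise.
case/orP => [/andP[/eqP w1 e]|cert].
  have := apart v w1; rewrite exceptional_single /=.
  by rewrite (@same_shape_normal_exceptional _ _ _ (Node tt (heavy_first tt l' r') Empty)) ?e //= shf.
set u := Node v (normalise l) (normalise r).
have lab : perm_eq xs (labels u ++ labels (normalise w)).
  rewrite /xs perm_sym perm_cat ?labels_normalise //= perm_cons.
  by rewrite perm_cat ?labels_normalise.
have emb' : join_embedded u (normalise w).
  apply: join_embedded_perm emb => // x y; rewrite -join_adj_normalise.
  by rewrite /join_adj !is_root_normalise !tree_adj_normalise /= !is_root_normalise !tree_adj_normalise.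
rewrite -[X in (X%:R <= _)%R]/(size xs) (perm_size lab); apply: le_trans (rel_energy_perm _ a_sym _); last first.
  by rewrite perm_sym; apply: lab.
apply: certified_join_energy cert => //.
by rewrite /= ll' rr'.
Qed.

(** Induction on the number of nodes: cut below the edge found by [descend].  If
    the upper side w is exceptional the tree is one of the enumerated ones;
    otherwise neither side is, and superadditivity applies. *)
Lemma embedded_energy t : embedded t ->
  exceptional t \/ ((size (labels t))%:R <= rel_energy C a (labels t))%R.
Proof.
have [n] := ubnP (nnodes t); elim: n t => // n IHn t lt_tn emb.
have [exct|nexct] := boolP (exceptional t); [by left | right].
have [//|v [l [r [w [[lab jE] nexc excl excr apart]]]]] := @descend t Empty nexct.
have embj := join_embedded_perm lab jE (embedded_join emb).
rewrite [_ ++ labels Empty]cats0 in lab.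
rewrite (perm_size lab); apply: le_trans (rel_energy_perm _ a_sym _); last first.
  by rewrite perm_sym; apply: lab.
have [excw|nexcw] := boolP (exceptional w); first exact: settled_join_energy.
apply: le_trans (rel_energy_cat _ _ _ a_sym); rewrite size_cat natrD.
have sz := perm_size lab; rewrite size_cat in sz.
have w_gt0 : 0 < nnodes w by case: (w) nexcw.
have u_gt0 : 0 < nnodes (Node v l r) by [].
have lt_w : nnodes w < n by move: sz lt_tn u_gt0 w_gt0; rewrite /nnodes; lia.
have lt_u : nnodes (Node v l r) < n by move: sz lt_tn u_gt0 w_gt0; rewrite /nnodes; lia.
have [e|le_u] := IHn _ lt_u (join_embedded_left embj); first by rewrite e in nexc.
have [e|le_w] := IHn _ lt_w (join_embedded_left (join_embeddedC embj)).
  by rewrite e in nexcw.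
exact: lerD.
Qed.
End Decomposition.

(** * Presenting a tree as a binary tree *)

Section Growth.
Variable G : sgraph.
Implicit Types (x y z v : G) (xs ys : seq G) (t l : btree G).

(** Orders in which a tree can be built, latest vertex first.  Connectivity
    provides a next vertex, and acyclicity makes its earlier neighbour unique. *)
Inductive grown (r : G) : seq G -> Prop :=
| Grown1 : grown r [:: r]
| GrownS y ys of grown r ys & y \notin ys & count (@adj G y) ys = 1 :
    grown r (y :: ys).

Lemma grown_uniq r xs : grown r xs -> uniq xs.
Proof. by elim=> //= y ys _ -> ->. Qed.

Lemma grown_root r xs : grown r xs -> r \in xs.
Proof. by elim=> [|y ys _ ry _ _]; rewrite inE ?eqxx // ry orbT. Qed.

Definition adj_in xs : rel G := fun x y => [&& x \in xs, y \in xs & adj x y].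

Lemma grown_connect r xs x : grown r xs -> x \in xs -> connect (adj_in xs) x r.
Proof.
move=> xs_r; elim: xs_r x => [|y ys ys_r IHys _ y1] x.
  by rewrite inE => /eqP->.
have mono : subrel (connect (adj_in ys)) (connect (adj_in (y :: ys))).
  apply: connect_sub => a b /and3P[ay b_y ab]; apply: connect1.
  by rewrite /adj_in !inE ay b_y ab !orbT.
rewrite inE => /orP[/eqP->|xys]; last exact/mono/IHys.
have /hasP[z zys yz] : has (@adj G y) ys by rewrite has_count y1.
apply: connect_trans (mono _ _ (IHys z zys)).
by apply: connect1; rewrite /adj_in mem_head inE zys yz orbT.
Qed.

(** Two neighbours of y in the connected set xs would close a cycle through y. *)
Lemma grown_count r xs y : acyclic G -> grown r xs -> y \notin xs ->
  count (@adj G y) xs <= 1.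
Proof.
move=> acy xs_r yxs; rewrite leqNgt -size_filter; apply/negP.
have: uniq (filter (@adj G y) xs) by rewrite filter_uniq ?(grown_uniq xs_r).
have: {subset filter (@adj G y) xs <= [pred x | adj y x && (x \in xs)]}.
  by move=> x; rewrite mem_filter.
case: (filter _ _) => [|x1 [|x2 s]] // sub /andP[x1s _] _.
have /andP[yx1 x1xs] : adj y x1 && (x1 \in xs) by apply: (sub x1); rewrite mem_head.
have /andP[yx2 x2xs] : adj y x2 && (x2 \in xs).
  by apply: (sub x2); rewrite !inE eqxx orbT.
have x12 : x1 != x2 by apply: contraNneq x1s => ->; rewrite mem_head.
have in_sym : connect_sym (adj_in xs).
  by apply: sym_connect_sym => a b; rewrite /adj_in adj_sym andbCA.
have : connect (adj_in xs) x1 x2.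
  apply: connect_trans (grown_connect xs_r x1xs) _.
  by rewrite in_sym (grown_connect xs_r x2xs).
case/connectP=> p0 /shortenP[p p_path p_uniq _] x2E.
have p_xs : all (mem xs) p.
  elim: p x1 {yx1 x1xs x1s x12 sub p_uniq x2E} p_path => //= b p IHp a.
  by case/andP=> /and3P[_ -> _] /IHp.
have p_adj : path (@adj G) x1 p by apply: sub_path p_path => a b /and3P[].
have cyc : ucycle (@adj G) (y :: x1 :: p).
  apply/andP; split; first by rewrite /= rcons_path p_adj yx1 -x2E adj_sym yx2.
  rewrite cons_uniq p_uniq andbT; apply: contra yxs; rewrite inE.
  by case/orP=> [/eqP->|/(allP p_xs)].
have := acy _ cyc; case: p x2E {p_path p_uniq p_xs p_adj cyc} => //= x21.
by rewrite x21 eqxx in x12.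
Qed.

Lemma path_exit xs x p : path (@adj G) x p -> x \in xs -> last x p \notin xs ->
  exists u v, [/\ u \in xs, v \notin xs & adj u v].
Proof.
elim: p x => [|y p IHp] x /=; first by move=> _ ->.
case/andP=> xy p_path xxs; have [yxs|yxs _] := boolP (y \in xs); first exact: IHp.
by exists x, y.
Qed.

Lemma grown_spanning r : connected G -> acyclic G ->
  exists2 xs, grown r xs & forall x, x \in xs.
Proof.
move=> conn acy.
suff [xs xs_r [big|all_xs]] : exists2 xs, grown r xs &
    #|G| < size xs \/ forall x, x \in xs.
- have := max_card (mem xs); rewrite (card_uniqP (grown_uniq xs_r)).
  by rewrite leqNgt big.
- by exists xs.
elim: #|G| => [|n [xs xs_r [lt_n|all_xs]]].
- by exists [:: r]; [exact: Grown1 | left].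
- have [/forallP all_xs|] := boolP [forall x, x \in xs].
    by exists xs => //; right.
  rewrite negb_forall => /existsP[z zxs].
  have /connectP[p p_path zE] := conn r z.
  have [|u [v [uxs vxs uv]]] := path_exit p_path (grown_root xs_r).
    by rewrite -zE.
  exists (v :: xs); last by left.
  apply: GrownS => //; apply/eqP; rewrite eqn_leq (grown_count acy xs_r vxs).
  by rewrite -has_count; apply/hasP; exists u; rewrite // adj_sym.
- by exists xs => //; right.
Qed.

Lemma count_le_degree x ys : uniq ys -> count (@adj G x) ys <= degree x.
Proof.
move=> ys_uniq; rewrite -size_filter /degree.
rewrite -(card_uniqP (filter_uniq (@adj G x) ys_uniq)).
by apply: subset_leq_card; apply/subsetP => z; rewrite mem_filter inE => /andP[].
Qed.

(** The last vertex added in an order of construction is a leaf, or the only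
    vertex. *)
Lemma low_degree : is_tree G -> exists r : G, degree r <= 2.
Proof.
case=> /card_gt0P[r0 _] conn acy.
have [xs xs_r all_xs] := grown_spanning r0 conn acy.
have degE x : degree x = count (@adj G x) xs.
  rewrite -size_filter -(card_uniqP (filter_uniq _ (grown_uniq xs_r))) /degree.
  by apply: eq_card => z; rewrite mem_filter inE all_xs andbT.
case: {all_xs} xs / xs_r degE => [|y ys _ _ y1] degE.
  by exists r0; rewrite degE /= adj_irr.
by exists y; rewrite degE /= adj_irr y1.
Qed.

(** When both branches of x are occupied the right one is overwritten; the
    degree condition of [attachP] excludes this. *)
Fixpoint attach t x y :=
  if t is Node v l r then
    if v == x then
      if l is Empty then Node v (Node y Empty Empty) r
      else Node v l (Node y Empty Empty)
    else if x \in labels l then Node v (attach l x y) r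
    else Node v l (attach r x y)
  else Empty.

Lemma count_left v l r x :
  count (tree_adj l x) (labels l) + is_root l x <=
  count (tree_adj (Node v l r) x) (labels (Node v l r)).
Proof.
rewrite /= count_cat addnC leq_add //.
  by case: (is_root l x); rewrite //= eqxx /= orbT.
by apply: leq_trans (leq_addr _ _); apply: sub_count => z /= ->; rewrite !orbT.
Qed.

Lemma count_right v l r x :
  count (tree_adj r x) (labels r) + is_root r x <=
  count (tree_adj (Node v l r) x) (labels (Node v l r)).
Proof.
rewrite /= count_cat addnC leq_add //.
  by case: (is_root r x); rewrite //= eqxx /= !orbT.
by apply: leq_trans (leq_addl _ _); apply: sub_count => z /= ->; rewrite !orbT.
Qed.

(** The degree condition leaves a free branch at x: a node with two branches has
    two neighbours below it, and one more above it unless it is the root. *)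
Lemma attachP t x y : uniq (labels t) -> x \in labels t ->
  count (tree_adj t x) (labels t) + is_root t x <= 2 ->
  [/\ perm_eq (labels (attach t x y)) (y :: labels t),
      is_root (attach t x y) =1 is_root t &
      forall a b, tree_adj (attach t x y) a b =
        [|| tree_adj t a b, (a == x) && (b == y) | (a == y) && (b == x)]].
Proof.
elim: t => // v l IHl r IHr t_uniq xt deg.
have degl := leq_trans (count_left v l r x) (leq_trans (leq_addr _ _) deg).
have degr := leq_trans (count_right v l r x) (leq_trans (leq_addr _ _) deg).
move: t_uniq xt deg => /= /andP[v_lr].
rewrite cat_uniq => /and3P[l_uniq /hasPn dis r_uniq].
have vl : v \notin labels l by apply: contra v_lr; rewrite mem_cat => ->.
have vr : v \notin labels r by apply: contra v_lr; rewrite mem_cat orbC => ->.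
rewrite inE mem_cat eq_sym; case: eqP => [<- _|/eqP vx] /=.
  case: l {IHl degl degr} l_uniq dis vl v_lr => [|lv ll lr] _ _ _ _ deg.
    split=> // [|a b] /=; first by apply/permPl; exact: (perm_catCA [:: v] [:: y] (labels r)).
    by case: (a == v); case: (b == v); case: (a == y); case: (b == y);
      rewrite /= ?orbT ?orbF.
  case: r deg {IHr r_uniq vr} => [|rv rl rr] deg.
    split=> // [|a b] /=.
      rewrite !cats0 cats1 -[y :: v :: _](rotr1_rcons y (v :: lv :: _)).
      by rewrite perm_sym perm_rotr.
    by case: (a == v); case: (b == v); case: (a == y); case: (b == y);
      rewrite /= ?orbT ?orbF.
  move: deg; rewrite /= !eqxx count_cat /= !eqxx /= orbT /=; clear.
  move: (nat_of_bool _) => b; do 2![move: (count _ _) => ?]; lia.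
have [xl _|xl xr] := boolP (x \in labels l) => _.
  have [pl rl tl] := IHl l_uniq xl degl.
  split=> // [|a b] /=.
  have swap : perm_eq (v :: y :: labels l ++ labels r) (y :: v :: labels l ++ labels r).
      by apply/permPl; exact: (perm_catCA [:: v] [:: y]).
    apply: perm_trans swap; rewrite /= perm_cons -[y :: _ ++ _]cat_cons.
    by rewrite perm_cat2r.
  by rewrite tl !rl -!orbA; congr [|| _, _, _ | _]; rewrite orbA orbC.
have [pr rr tr] := IHr r_uniq xr degr.
split=> // [|a b] /=.
  have swap : perm_eq ((v :: labels l) ++ y :: labels r) (y :: v :: labels l ++ labels r).
    by apply/permPl; exact: (perm_catCA (v :: labels l) [:: y]).
  by apply: perm_trans swap; rewrite /= perm_cons perm_cat2l.
by rewrite tr !rr -!orbA.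
Qed.
End Growth.

Section Build.
Variable G : sgraph.
Implicit Types (x y z : G) (xs : seq G) (t : btree G).

(** A new vertex y attached to x accounts for one neighbour of x not yet present,
    which provides the degree condition of [attachP]. *)
Lemma grown_embedded r xs : (forall x, degree x <= 3) -> degree r <= 2 ->
  grown r xs ->
  exists t, [/\ embedded (@adj G) t, perm_eq (labels t) xs &
                forall x, is_root t x = (x == r)].
Proof.
move=> deg3 degr; elim=> [|y ys ys_r [t [[t_uniq adjE] lab root]] yys y1].
  exists (Node r Empty Empty); split=> //; split=> // a b.
  rewrite !inE => /eqP-> /eqP->; rewrite adj_irr /=.
  by rewrite !andbF.
have ylab : y \notin labels t by rewrite (perm_mem lab).
have ly1 : count (@adj G y) (labels t) = 1 by rewrite (seq.permP lab).
have /hasP[x xlab yx] : has (@adj G y) (labels t) by rewrite has_count ly1.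
have cnt : count (tree_adj t x) (labels t) + is_root t x <= 2.
  have -> : count (tree_adj t x) (labels t) = count (@adj G x) (labels t).
    by apply: eq_in_count => z zlab; rewrite adjE.
  have : count (@adj G x) (y :: labels t) <= degree x.
    by apply: count_le_degree; rewrite /= ylab.
  rewrite /= adj_sym yx root add1n => lt_deg.
  case: eqP => [xr|_]; last by rewrite addn0 -ltnS (leq_trans lt_deg).
  by rewrite addn1 (leq_trans lt_deg) ?xr.
have [pt rt tt'] := attachP y t_uniq xlab cnt.
exists (attach t x y); split; first split.
- by rewrite (perm_uniq pt) /= ylab.
- move=> a b; rewrite !(perm_mem pt) !inE tt'.
  have only z : z \in labels t -> adj y z = (z == x).
    move=> zlab; apply/idP/eqP => [yz|->//]; apply/eqP/negPn/negP => zx.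
    have : count (predU (pred1 z) (pred1 x)) (labels t) <= 1.
      rewrite -ly1; apply: sub_count => c /=.
      by case/orP=> /eqP->.
    rewrite -(leq_add2r (count (predI (pred1 z) (pred1 x)) (labels t))).
    rewrite count_predUI !count_uniq_mem // zlab xlab /=.
    rewrite (@eq_count _ _ pred0) ?count_pred0 // => c /=.
    by apply/andP=> -[/eqP-> /eqP zx']; rewrite zx' eqxx in zx.
  have out z : z \in labels t -> (z == y) = false.
    by move=> zlab; apply: contraNF ylab => /eqP <-.
  have yx_neq : (y == x) = false by rewrite eq_sym out.
  have tree_adj_y z : tree_adj t y z = false.
    by apply: contraNF ylab; apply: tree_adj_labels.
  case/predU1P=> [->|alab] /predU1P[->|blab].
  + by rewrite adj_irr tree_adj_y yx_neq andbF.
  + by rewrite only // tree_adj_y yx_neq eqxx.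
  + by rewrite adj_sym only // tree_adj_sym tree_adj_y eqxx andbT (out _ alab) /= orbF.
  + by rewrite adjE // (out _ alab) (out _ blab) !andbF /= orbF.
- by apply: perm_trans pt _; rewrite perm_cons.
- by move=> z; rewrite rt root.
Qed.

Lemma tree_embedded : is_tree G -> max_degree G <= 3 ->
  exists2 t, embedded (@adj G) t & forall x, x \in labels t.
Proof.
move=> G_tree deg3; have [r degr] := low_degree G_tree.
have [_ conn acy] := G_tree; have [xs xs_r all_xs] := grown_spanning r conn acy.
have degx x : degree x <= 3 by apply: leq_trans deg3; apply: leq_bigmax.
have [t [emb lab _]] := grown_embedded degx degr xs_r.
by exists t => // x; rewrite (perm_mem lab).
Qed.

Lemma embedded_normalise t : embedded (@adj G) t -> embedded (@adj G) (normalise t).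
Proof.
move=> [t_uniq adjE]; split; first by rewrite (perm_uniq (labels_normalise t)).
by move=> x y; rewrite !(perm_mem (labels_normalise t)) tree_adj_normalise; apply: adjE.
Qed.

(** The sequence sigma lists the images, in the reference graph h, of the nodes of
    s in preorder. *)
Definition renumbers n (h : rel nat) (s : btree unit) (sigma : seq nat) : bool :=
  [&& nnodes s == n, perm_eq sigma (iota 0 n) &
    all (fun i => all (fun j => h (nth 0 sigma i) (nth 0 sigma j) ==
                                tree_adj (preorder 0 s) i j) (iota 0 n)) (iota 0 n)].

Lemma shape_isomorphic n (h : rel nat) (H : rel 'I_n.+1) H_sym H_irr s sigma t :
  (forall i j : 'I_n.+1, H i j = h i j) -> renumbers n.+1 h s sigma ->
  embedded (@adj G) t -> (forall x, x \in labels t) -> same_shape t s ->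
  isomorphic G (@SGraph 'I_n.+1 H H_sym H_irr).
Proof.
move=> Hh /and3P[/eqP sz sig_perm /allP ren] [t_uniq adjE] all_t ts.
have szt : size (labels t) = n.+1 by rewrite -sz -(same_shape_nnodes ts).
have lt_idx x : index x (labels t) < n.+1 by rewrite -szt index_mem.
have sz_sig : size sigma = n.+1 by rewrite (perm_size sig_perm) size_iota.
have sig_uniq : uniq sigma by rewrite (perm_uniq sig_perm) iota_uniq.
have lt_sig i : i < n.+1 -> nth 0 sigma i < n.+1.
  move=> lt_i; have : nth 0 sigma i \in iota 0 n.+1.
    by rewrite -(perm_mem sig_perm) mem_nth // sz_sig.
  by rewrite mem_iota.
pose f x : 'I_n.+1 := Ordinal (lt_sig _ (lt_idx x)).
exists f.
  apply: inj_card_bij.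
    move=> x y /(congr1 val) /= /eqP.
    rewrite nth_uniq ?sz_sig // => /eqP /(congr1 (nth x (labels t))).
    by rewrite !nth_index.
  rewrite card_ord -szt -(card_uniqP t_uniq).
  by apply: subset_leq_card; apply/subsetP.
move=> x y /=; rewrite Hh /= adjE //.
have iP z : index z (labels t) \in iota 0 n.+1 by rewrite mem_iota /=.
have /allP/(_ _ (iP y))/eqP-> := ren _ (iP x).
have rel_t : relabel (nth x (labels t)) (preorder 0 s) = t.
  exact: relabel_preorder.
have f_inj : {in (fun k => k < n.+1) &, injective (nth x (labels t))}.
  by move=> i j lt_i lt_j /eqP; rewrite nth_uniq ?szt // => /eqP.
have lt_lab : {subset labels (preorder 0 s) <= (fun k => k < n.+1)}.
  by move=> k; rewrite labels_preorder mem_iota sz.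
have := tree_adj_relabel f_inj lt_lab (lt_idx x) (lt_idx y).
by rewrite rel_t !nth_index.
Qed.

Lemma exceptional_isomorphic t : embedded (@adj G) t -> (forall x, x \in labels t) ->
  0 < #|G| -> exceptional t ->
  [\/ isomorphic G K1, isomorphic G (star 2), isomorphic G (star 3)
    | isomorphic G binary7].
Proof.
move=> emb all_t G_gt0 /exceptionalP[s sS ts].
have emb' := embedded_normalise emb.
have all_t' x : x \in labels (normalise t) by rewrite (perm_mem (labels_normalise t)).
have star_nat k (i j : 'I_k.+1) : star_adj i j = ((i == 0 :> nat) (+) (j == 0 :> nat)).
  by [].
have iso n h H H_sym H_irr sigma Hh ren :=
  @shape_isomorphic n h H H_sym H_irr s sigma _ Hh ren emb' all_t' ts.
move: sS iso; rewrite !inE.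
case/or4P => [/eqP sE|/eqP-> iso|/eqP-> iso|/or4P[/eqP-> iso|/eqP-> iso|/eqP-> iso|/eqP-> iso]].
- case/card_gt0P: G_gt0 => x _; have := all_t' x.
  by move: ts; rewrite sE; case: (normalise t).
- by constructor 1; apply: (iso 0 (fun _ _ => false) _ _ _ [:: 0]).
- by constructor 2; apply: (iso _ (fun i j => (i == 0) (+) (j == 0)) _ _ _ [:: 0; 1; 2]).
- by constructor 2; apply: (iso _ (fun i j => (i == 0) (+) (j == 0)) _ _ _ [:: 1; 0; 2]).
- by constructor 3; apply: (iso _ (fun i j => (i == 0) (+) (j == 0)) _ _ _ [:: 1; 0; 2; 3]).
- by constructor 4; apply: (iso _ (fun i j => heap_child i j || heap_child j i)
    _ _ _ [:: 0; 1; 3; 4; 2; 5; 6]).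
- by constructor 4; apply: (iso _ (fun i j => heap_child i j || heap_child j i)
    _ _ _ [:: 3; 1; 0; 2; 5; 6; 4]).
Qed.
End Build.

Theorem theorem9 (R : realType) (T : sgraph) :
  is_tree T ->
  ~ isomorphic T K1 ->
  ~ isomorphic T (star 2) ->
  ~ isomorphic T (star 3) ->
  ~ isomorphic T binary7 ->
  max_degree T <= 3 ->
  (#|T|%:R <= energy R T :> R)%R.
Proof.
move=> T_tree noK1 noK12 noK13 noB7 deg3.
have [t emb all_t] := tree_embedded T_tree deg3.
have [T_gt0 _ _] := T_tree.
have [exct|] := embedded_energy (complex R) (@adj_sym T) emb.
  by have [] := exceptional_isomorphic emb all_t T_gt0 exct.
have [t_uniq _] := emb.
have -> : size (labels t) = #|T|.
  by rewrite -(card_uniqP t_uniq); apply: eq_card => x; rewrite all_t.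
move=> /le_trans/(_ (rel_energy_le_adjmx _ t_uniq all_t)).
by rewrite nuclear_adjmx -(rmorph_nat (real_complex R)) lecR.
Qed.
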